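(* Let $p\ge2$, let $\mathfrak{h}=(V,E)$ be a connected $p$-uniform and $2$-regular hypergraph and let $\pi$ be a partition of its vertex set $V$. Let $T=(T^{(N)})_{N\ge1}$ be a sequence of heavy-Wigner tensors of order $p$ with parameters $(M_k)_{k\ge 2}$ (and $M_1=0$). Then $$\lim_{N\to\infty}\mathbb{E}\left[\mathrm{tr}^0_{\mathfrak{h}^\pi}(T^{(N)})\right]=\mathbf{1}_{\{\mathfrak{h}^\pi\text{ is a }2\text{-divisible hypertree}\}}\prod_{r\ge1}M_r^{q_r},$$ where, when $\mathfrak{h}^\pi$ is a fat hypertree, $(q_r)_{r\ge1}$ denotes its type (with the convention $0^0=1$).
   Context: Heavy-Wigner tensors: a sequence of heavy-Wigner tensors of order $p$ with parameters $(M_k)_{k\ge2}$ is a sequence $(T^{(N)})_{N\ge1}$ of real random tensors $T^{(N)}=(T_{i_1,\dots,i_p})_{1\le i_1,\dots,i_p\le N}$ that are symmetric (invariant under permutation of the indices), whose entries indexed by $i_1\le\cdots\le i_p$ are independent (not necessarily identically distributed), such that $\mathbb{E}[T_{i_1,\dots,i_p}]=0$ for all indices (set $M_1=0$), for every $k\ge2$ one has $\sup_{i_1,\dots,i_p}N^{p-1}\mathbb{E}[T_{i_1,\dots,i_p}^k]=O(1)$ as $N\to\infty$, and for all $i_1<\cdots<i_p$ and every $k\ge2$, $N^{p-1}\mathbb{E}[T_{i_1,\dots,i_p}^k]\to M_k$ as $N\to\infty$. Hypergraphs: a hypergraph $(V,E)$ has a finite vertex set $V$ and a finite multiset $E$ of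 hyperedges, each hyperedge being a multiset of vertices. It is $p$-uniform if each hyperedge has $p$ vertices counted with multiplicity, and $2$-regular if each vertex has degree $2$, the degree of $v$ being the sum over hyperedges of the multiplicity of $v$ in the hyperedge. Its incidence bipartite graph has vertex set $V\sqcup E$, with as many edges between $v$ and $e$ as the multiplicity of $v$ in $e$; the hypergraph is connected if this graph is. A hypergraph is simple if hyperedges are not repeated and each consists of pairwise distinct vertices. A hypertree is a simple hypergraph whose incidence bipartite graph is a tree. A fat hypertree is a hypergraph such that forgetting the multiplicities of hyperedges yields a hypertree; its type is $(q_r)_{r\ge1}$ where $q_r$ is the number of distinct hyperedges occurring with multiplicity exactly $r$. A $2$-divisible hypertree is a fat hypertree all of whose hyperedge multiplicities are even ($q_r=0$ for $r$ odd). For a partition $\pi$ of $V$, $\mathfrak{h}^\pi$ is the hypergraph obtained from $\mathfrak{h}$ by identifying vertices in the same block of $\pi$ (keeping all hyperedges, with multiplicity). Traces: for a symmetric tensor $T$ of order $p$ and dimension $N$ and a connected $p$-uniform hypergraph $\mathfrak{g}$, $$\mathrm{Tr}^0_{\mathfrak{g}}(T)=\sum_{\phi:V(\mathfrak{g})\to[N]\text{ injective}}\ \prod_{e=\{v_1,\dots,v_p\}\in E(\mathfrak{g})}T_{\phi(v_1),\dots,\phi(v_p)},\qquad \mathrm{tr}^0_{\mathfrak{g}}(T)=\frac1N\mathrm{Tr}^0_{\mathfrak{g}}(T).$$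
   Formalization: The convergence N^{p-1}E[T_{i_1,...,i_p}^k] → M_k is taken uniformly over all i_1<...<i_p in [N]; if it held only for each fixed tuple the claim would fail (e.g. p=2, doubling the variance of entries having an index above N/2). *)

(* Defs.v *)
From HB Require Import structures.
From mathcomp Require Import all_boot all_order all_fingroup all_algebra.
From mathcomp Require Import finmap multiset.
From mathcomp Require Import all_classical all_reals all_analysis.

Set Implicit Arguments.
Unset Strict Implicit.
Unset Printing Implicit Defensive.

Import Order.TTheory GRing.Theory Num.Theory.
Import numFieldNormedType.Exports.

Local Open Scope classical_set_scope.
Local Open Scope ring_scope.

Section Hypergraphs.
Local Open Scope nat_scope.

(* [h e] is the multiplicity of the hyperedge [e] in [h], and [e v] that of the
   vertex [v] in [e].  Multisets coerce to sequences listing their elements with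
   repetition, so [\sum_(e <- h)] and [size h] count multiplicities. *)
Definition hypergraph (V : finType) := {mset {mset V}}%mset.

Identity Coercion multiset_of_hypergraph : hypergraph >-> multiset_of.

Definition uniform (p : nat) (V : finType) (h : hypergraph V) : Prop :=
  forall e : {mset V}%mset, e \in h -> size e = p.

Definition degree (V : finType) (h : hypergraph V) (v : V) : nat :=
  \sum_(e <- h) e v.

Definition regular (k : nat) (V : finType) (h : hypergraph V) : Prop :=
  forall v : V, degree h v = k.

(* Adjacency in the incidence bipartite graph.  The second summand has one node
   per hyperedge counted with multiplicity.  Parallel edges of the incidence
   graph are not recorded: they are irrelevant for connectedness, and absent
   for simple hypergraphs, the only ones for which acyclicity is considered. *)
Definition incidence (V : finType) (h : hypergraph V) : rel (V + 'I_(size h)) :=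
  fun x y => match x, y with
  | inl v, inr j | inr j, inl v => v \in (nth mset0 h j : {mset V}%mset)
  | _, _ => false
  end.
Arguments incidence {V} h.

Definition connected_graph (G : finType) (e : rel G) : Prop :=
  0 < #|G| /\ forall x y : G, connect e x y.

(* For a symmetric irreflexive [e], the [ucycle]s of size 1 do not exist and
   those of size 2 are back-and-forth walks along one edge, which are not cycles
   in the sense of graph theory. *)
Definition acyclic_graph (G : finType) (e : rel G) : Prop :=
  forall s : seq G, ucycle e s -> size s <= 2.

Definition tree (G : finType) (e : rel G) : Prop :=
  connected_graph e /\ acyclic_graph e.

Definition hconnected (V : finType) (h : hypergraph V) : Prop :=
  connected_graph (incidence h).

Definition hsimple (V : finType) (h : hypergraph V) : Prop :=
  forall e : {mset V}%mset, h e <= 1 /\ (e \in h -> forall v : V, e v <= 1).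

Definition hypertree (V : finType) (h : hypergraph V) : Prop :=
  hsimple h /\ tree (incidence h).

Definition forget_mult (V : finType) (h : hypergraph V) : hypergraph V :=
  seq_mset (undup h).

Definition fat_hypertree (V : finType) (h : hypergraph V) : Prop :=
  hypertree (forget_mult h).

(* The number q_r of distinct hyperedges of multiplicity exactly [r]. *)
Definition htype (V : finType) (h : hypergraph V) (r : nat) : nat :=
  count (fun e : {mset V}%mset => h e == r) (undup h).

Definition two_divisible_hypertree (V : finType) (h : hypergraph V) : Prop :=
  fat_hypertree h /\ forall e : {mset V}%mset, e \in h -> ~~ odd (h e).

Section Quotient.
Variables (V : finType) (pi : {set {set V}}).
Hypothesis pi_part : finset.partition pi [set: V]%SET.

Lemma pblock_in_part (v : V) : finset.pblock pi v \in pi.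
Proof.
by rewrite finset.pblock_mem // (finset.cover_partition pi_part) finset.in_setT.
Qed.

Definition block (v : V) : {B : {set V} | B \in pi} :=
  exist _ (finset.pblock pi v) (pblock_in_part v).

Definition hquotient (h : hypergraph V) : hypergraph {B : {set V} | B \in pi} :=
  seq_mset [seq seq_mset [seq block v | v <- (e : {mset V}%mset)] | e <- h].

End Quotient.
End Hypergraphs.

Section Tensors.
Variable R : realType.

Definition tensor (p N : nat) := p.-tuple 'I_N -> R.

(* The entry of [t] at the labels of the elements of [e], listed in an arbitrary
   order, which is immaterial for symmetric [t].  The default value 0 is used
   only when [e] does not have [p] elements. *)
Definition edge_entry (p N : nat) (t : tensor p N) (V : finType)
    (phi : V -> 'I_N) (e : {mset V}%mset) : R :=
  oapp t 0 (insub [seq phi v | v <- e]).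

Definition Tr0 (p N : nat) (V : finType) (g : hypergraph V) (t : tensor p N) : R :=
  \sum_(phi : {ffun V -> 'I_N} | injectiveb phi)
    \prod_(e <- g) edge_entry t phi e.

Definition tr0 (p N : nat) (V : finType) (g : hypergraph V) (t : tensor p N) : R :=
  N%:R^-1 * Tr0 g t.

End Tensors.

(* Mutual independence of the random variables [X i], [i] in [D]. *)
Definition mutually_independent (R : realType) (d : measure_display)
    (Omega : measurableType d) (P : probability Omega R)
    (I : finType) (D : {set I}) (X : I -> {RV P >-> R}) : Prop :=
  forall (J : {set I}) (A : I -> set R),
    J \subset D -> (forall i, measurable (A i)) ->
    P (\bigcap_(i in [set` J]) X i @^-1` A i)
      = (\prod_(i in J) P (X i @^-1` A i))%E.

(* The expectation of [(X i)^k], scaled by [N^(p-1)]. *)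
Definition scaled_moment (R : realType) (d : measure_display)
    (Omega : measurableType d) (P : probability Omega R) (p N : nat)
    (X : p.-tuple 'I_N -> {RV P >-> R}) (k : nat) (i : p.-tuple 'I_N) : \bar R :=
  ((N%:R ^+ p.-1)%:E * 'E_P[fun w => (X i w ^+ k)%R])%E.

(* The index [N] starts at 1 in the mathematical definition; for [N = 0] and
   [p > 0] there are no entries and all the conditions are void.
   The convergence of the moments is uniform in the (increasing) indices: the
   index set grows with [N], so convergence for each fixed index tuple would put
   no condition on most entries of [T N]. *)
Record heavy_wigner (R : realType) (p : nat) (d : nat -> measure_display)
    (Omega : forall N, measurableType (d N))
    (P : forall N, probability (Omega N) R)
    (T : forall N, p.-tuple 'I_N -> {RV (P N) >-> R}) (M : nat -> R) : Prop := {
  hw_symmetric : forall N (i : p.-tuple 'I_N) (s : 'S_p) (w : Omega N),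
    T N [tuple tnth i (s k) | k < p] w = T N i w ;
  hw_independent : forall N,
    mutually_independent
      [set i : p.-tuple 'I_N | sorted leq [seq val j | j <- i]]%SET (T N) ;
  hw_centered : forall N (i : p.-tuple 'I_N), ('E_(P N)[T N i] = 0)%E ;
  hw_bounded : forall k, (2 <= k)%N -> exists C : R, \forall N \near \oo,
    (`| ereal_sup [set scaled_moment (T N) k i | i in [set: p.-tuple 'I_N]] |
       <= C%:E)%E ;
  hw_moments : forall k, (2 <= k)%N -> forall eps : R, 0 < eps ->
    \forall N \near \oo, forall i : p.-tuple 'I_N,
      sorted ltn [seq val j | j <- i] ->
      (`| scaled_moment (T N) k i - (M k)%:E | <= eps%:E)%E
}.

(* Main.v *)
Require Import Defs.
From HB Require Import structures.
From mathcomp Require Import all_boot all_order all_fingroup all_algebra.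
From mathcomp Require Import finmap multiset.
From mathcomp Require Import all_classical all_reals all_analysis.
From mathcomp Require Import measurable_realfun ring.

Set Implicit Arguments.
Unset Strict Implicit.
Unset Printing Implicit Defensive.

Import Order.TTheory GRing.Theory Num.Theory.
Import numFieldNormedType.Exports.

Local Open Scope classical_set_scope.
Local Open Scope ring_scope.

(** Write [g] for the quotient, with [n] vertices and [q] distinct hyperedges.
    Distinct hyperedges of [g] are sent by an injective labelling to distinct
    independent entries, so the expectation is [1/N] times a sum, over injective
    labellings, of products of [q] moments, each [O(N^-(p-1))].  There are about
    [N^n] labellings, hence the expectation is [O(N^(n - 1 - q(p-1)))].  Counting
    edges in the (connected) incidence graph of the underlying simple hypergraph
    gives [n + q - 1 <= pq], with equality exactly for fat hypertrees; in that
    case the rescaled moments converge uniformly to the product of the [M_r].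
    All degrees of [g] are even, and in a fat hypertree this forces all
    multiplicities to be even, so fat hypertrees are automatically 2-divisible. *)

(** * Counting edges of finite graphs *)

Section GraphCounting.
Local Open Scope nat_scope.
Variables (G : finType).
Implicit Types (e : rel G) (S : {set G}).

Definition degree_in e S (x : G) := \sum_(y in S) e x y.

(** Ordered pairs are counted, so for a symmetric irreflexive [e] this is twice the number of edges
    induced on [S]; hence the factors 2 below. *)
Definition arcs_in e S := \sum_(x in S) degree_in e S x.

Lemma arcs_inU1 e S x : symmetric e -> irreflexive e -> x \notin S ->
  arcs_in e (x |: S)%SET = arcs_in e S + 2 * degree_in e S x.
Proof.
move=> e_sym e_irr xS; rewrite /arcs_in /degree_in big_setU1 //= big_setU1 //= e_irr add0n.
under [X in _ + X]eq_bigr => i _ do rewrite big_setU1 //=.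
rewrite big_split /= mulSn mul1n addnA addnC; congr (_ + (_ + _)).
by apply: eq_bigr => i _; rewrite e_sym.
Qed.

Lemma degree_in_neq0 e S x : degree_in e S x != 0 -> exists2 y, y \in S & e x y.
Proof.
rewrite /degree_in sum_nat_eq0 negb_forall => /existsP[y].
by rewrite negb_imply => /andP[yS]; case exy: (e x y) => // _; exists y.
Qed.

Lemma degree_in_gt1 e S x : 1 < degree_in e S x ->
  exists y z, [/\ y \in S, z \in S, y != z & e x y && e x z].
Proof.
move=> d2; have [y yS exy] : exists2 y, y \in S & e x y.
  by apply: degree_in_neq0; rewrite -lt0n ltnW.
have [z] : exists2 z, z \in (S :\ y)%SET & e x z.
  apply: degree_in_neq0; move: d2.
  by rewrite /degree_in (big_setD1 y) //= exy ltnS lt0n.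
rewrite !inE => /andP[zy zS] exz; exists y, z; split=> //; first by rewrite eq_sym.
by rewrite exy.
Qed.

Lemma two_le_degree_in e S x y z : y \in S -> z \in S -> y != z -> e x y -> e x z ->
  1 < degree_in e S x.
Proof.
move=> yS zS yz exy exz; rewrite /degree_in (big_setD1 y) //= exy.
by rewrite (big_setD1 z) ?inE 1?eq_sym ?yz //= exz.
Qed.

(** A set grown from one vertex, always by a vertex adjacent to it, gains an edge at each step, so a
    connected graph on [n] vertices has at least [n - 1] edges. *)
Lemma connected_arcs e : symmetric e -> irreflexive e -> connected_graph e ->
  2 * #|G| <= arcs_in e [set: G]%SET + 2.
Proof.
move=> e_sym e_irr [G0 econ].
have [r _] := card_gt0P G0.
have grow k : k < #|G| -> exists S, [/\ r \in S, #|S| = k.+1 & 2 * k <= arcs_in e S].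
  elim: k => [_|k IH kG]; first by exists [set r]%SET; rewrite inE eqxx cards1.
  have [S [rS Sk arcS]] := IH (ltnW kG).
  have [x xS] : exists x, x \notin S.
    apply/existsP; rewrite -negb_forall; apply/negP => /forallP Sall.
    by move: kG; rewrite -Sk ltnNge => /negP; apply; apply/subset_leq_card/fintype.subsetP.
  have [y yS exy] : exists2 y, y \notin S & degree_in e S y != 0.
    apply: contrapT => nex.
    (* If no outside vertex had a neighbour in [S], then [S] would be closed under adjacency and
       contain everything connected to [r]. *)
    have Scl : fingraph.closed e (mem S).
      apply: (intro_closed (sym_connect_sym e_sym)) => u v euv uS.
      apply: contrapT => /negP vS; apply: nex.
      exists v => //; rewrite /degree_in (big_setD1 u) //=.
      by rewrite e_sym euv.
    by move: xS; rewrite -[_ \in _](closed_connect Scl (econ r x)) rS.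
  exists (y |: S)%SET; rewrite !inE rS orbT cardsU1 yS Sk; split=> //.
  by rewrite arcs_inU1 // mulnS addnC leq_add // leq_pmulr // lt0n.
have [S [_ SG arcS]] := grow #|G|.-1 ltac:(by rewrite prednK).
have -> : [set: G]%SET = S.
  apply/eqP; rewrite eq_sym finset.eqEcard finset.subsetT cardsT SG.
  by rewrite prednK /=.
by rewrite -[#|G|]prednK // mulnS addnC leq_add2r.
Qed.

(** Deleting one edge of a cycle keeps the graph connected, and [connected_arcs] applies to what
    remains. *)
Lemma cycle_arcs e s : symmetric e -> irreflexive e -> connected_graph e ->
  ucycle e s -> 2 < size s -> 2 * #|G| <= arcs_in e [set: G]%SET.
Proof.
move=> e_sym e_irr [G0 econ] /andP[].
case: s => [//|x [//|y [//|z s]]] cyc unq _.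
(* The graph [e] without the first edge [xy] of the cycle. *)
pose e' : rel G := fun u v =>
  e u v && ~~ ((u == x) && (v == y) || (u == y) && (v == x)).
have e'sym : symmetric e'.
  by move=> u v; rewrite /e' e_sym orbC [(v == x) && _]andbC [(v == y) && _]andbC.
have e'irr : irreflexive e' by move=> u; rewrite /e' e_irr.
have [exy eyz pz] : [/\ e x y, e y z & path e z (rcons s x)].
  by move: cyc => /= /and3P[].
have [xy xz yz] : [/\ x != y, x != z & y != z].
  by move: unq; rewrite /= !inE !negb_or => /and3P[/and3P[-> -> _] /andP[-> _]].
(* The rest of the cycle leads from [y] back to [x]; from [z] onward it never visits [y], so it
   avoids the deleted edge. *)
have yx : connect e' y x.
  apply/connectP; exists (z :: rcons s x); last by rewrite /= last_rcons.
  rewrite /= /e' eyz (eq_sym y x) (negbTE xy) (eq_sym z x) (negbTE xz) andbF /=.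
  apply: (@sub_in_path _ (predC1 y) e); last exact: pz.
    move=> u v; rewrite !inE => uy vy /= euv.
    by rewrite euv (negbTE uy) (negbTE vy) andbF.
  apply/allP => u; rewrite inE mem_rcons inE /= => uzs; apply: contraL uzs => /eqP ->.
  rewrite !negb_or yz eq_sym xy /=.
  by move: unq; rewrite /= !inE !negb_or => /and3P[_ /andP[]].
have xy' : connect e' x y by rewrite (sym_connect_sym e'sym).
have e'con : connected_graph e'.
  split=> // u v; have /connectP[c] := econ u v.
  elim: c u => [u _ ->|w c IH u /= /andP[euw pc] lc]; first exact: connect0.
  apply: connect_trans (IH _ pc lc).
  have [/orP[/andP[/eqP-> /eqP->]//|/andP[/eqP-> /eqP->]//]|ne] :=
    boolP ((u == x) && (w == y) || (u == y) && (w == x)).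
  by apply: connect1; rewrite /e' euw.
have -> : arcs_in e [set: G]%SET = arcs_in e' [set: G]%SET + 2.
  have sumT (F : G -> nat) : \sum_(u in [set: G]%SET) F u = \sum_u F u.
    by apply: eq_bigl => u; rewrite finset.in_setT.
  rewrite /arcs_in /degree_in !sumT.
  have E u : \sum_(v in [set: G]%SET) (e u v : nat) =
     \sum_(v in [set: G]%SET) (e' u v : nat) + ((u == x) + (u == y)).
    rewrite !sumT.
    have -> : (u == x) + (u == y) =
        \sum_v (((u == x) && (v == y)) + ((u == y) && (v == x))).
      rewrite big_split /= (bigD1 y) //= eqxx andbT big1 ?addn0; last first.
        by move=> v /negbTE ->; rewrite andbF.
      rewrite (bigD1 x) //= eqxx andbT big1 ?addn0 //.
      by move=> v /negbTE ->; rewrite andbF.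
    rewrite -big_split /=; apply: eq_bigr => v _; rewrite /e'.
    have [/andP[/eqP-> /eqP->]|_] := boolP ((u == x) && (v == y)).
      by rewrite exy (negbTE xy).
    have [/andP[/eqP-> /eqP->]|_] := boolP ((u == y) && (v == x)).
      by rewrite e_sym exy.
    by rewrite andbT !addn0.
  under eq_bigr => u _ do rewrite E.
  rewrite big_split /=; congr (_ + _); rewrite big_split /=.
  have H w : \sum_(i : G) (i == w : nat) = 1.
    by rewrite (bigD1 w) //= eqxx big1 // => v /negbTE ->.
  by rewrite !H.
exact: connected_arcs.
Qed.

(* Extend a simple path at its head for as long as possible: a neighbour of the
   head that already lies on the path and does not follow the head closes a cycle. *)
Lemma min_degree2_cycle e S : symmetric e -> irreflexive e ->
  S != finset.set0 -> (forall x, x \in S -> 1 < degree_in e S x) ->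
  exists2 s, ucycle e s & 2 < size s.
Proof.
move=> e_sym e_irr /set0Pn[r rS] deg2; apply: contrapT => nocyc.
have grow k : exists x s,
    [/\ size s = k, path e x s, uniq (x :: s) & all (mem S) (x :: s)].
  elim: k => [|k [x [s [sk pxs us aS]]]]; first by exists r, [::]; rewrite /= rS.
  have xS : x \in S by case/andP: aS.
  have nbr y : e x y -> y \in s -> index y s = 0.
    move=> exy ys; apply/eqP; rewrite -leqn0 leqNgt; apply/negP => iy.
    have ilt : index y s < size s by rewrite index_mem.
    apply: nocyc; exists (x :: take (index y s).+1 s); last first.
      by rewrite /= size_takel.
    have xy : last x (take (index y s).+1 s) = y.
      by rewrite (take_nth y) ?last_rcons ?nth_index.
    rewrite /ucycle /= rcons_path xy e_sym exy andbT.
    move: pxs; rewrite -{1}(cat_take_drop (index y s).+1 s) cat_path => /andP[-> _] /=.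
    move: us; rewrite /= -{1 2}(cat_take_drop (index y s).+1 s) cat_uniq mem_cat negb_or.
    by move=> /andP[/andP[-> _] /andP[-> _]].
  have [y [z [yS zS yz /andP[exy exz]]]] := degree_in_gt1 (deg2 x xS).
  have [w [wS exw wxs]] : exists w, [/\ w \in S, e x w & w \notin x :: s].
    have nx u : e x u -> (u \in x :: s) = (u \in s).
      by move=> exu; rewrite inE; case: eqP => // ux; rewrite ux e_irr in exu.
    have [ys|ys] := boolP (y \in s); last by exists y; rewrite nx.
    have [zs|zs] := boolP (z \in s); last by exists z; rewrite nx.
    by move: yz; rewrite -(nth_index x ys) -(nth_index x zs) !nbr // eqxx.
  exists w, (x :: s); split => /=; [by rewrite sk|by rewrite e_sym exw| |by rewrite wS].
  by rewrite wxs.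
(* A path of length [#|G|] would have [#|G| + 1] distinct vertices. *)
have [x [s [sG _ us _]]] := grow #|G|.
have := max_card (mem (x :: s)).
by rewrite (card_uniqP us) /= sG ltnn.
Qed.

(** Without cycles some vertex of [S] has degree at most 1 in [S]; removing it loses at most one
    edge, and induction gives at most [#|S| - 1] edges. *)
Lemma acyclic_arcs e S : symmetric e -> irreflexive e -> acyclic_graph e ->
  S != finset.set0 -> arcs_in e S + 2 <= 2 * #|S|.
Proof.
move=> e_sym e_irr eacy; have [n] := ubnP #|S|.
elim: n S => // n IH S Sn S0.
have [x xS dx] : exists2 x, x \in S & degree_in e S x <= 1.
  apply: contrapT => nex.
  have [s cs] : exists2 s, ucycle e s & 2 < size s.
    apply: min_degree2_cycle S0 _ => // x xS; rewrite ltnNge; apply/negP => dx.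
    by apply: nex; exists x.
  by rewrite ltnNge eacy.
have dx' : degree_in e (S :\ x)%SET x = degree_in e S x.
  by rewrite /degree_in [RHS](big_setD1 x) //= e_irr.
rewrite -(finset.setD1K xS) arcs_inU1 ?inE ?eqxx // cardsU1 !inE eqxx /= dx' mulnS.
have [Sx0|Sx0] := eqVneq (S :\ x)%SET finset.set0.
  move: dx'; rewrite Sx0 /arcs_in /degree_in !finset.big_set0 => <-.
  by rewrite finset.cards0.
have := IH (S :\ x)%SET; rewrite [#|S|](cardsD1 x) xS in Sn *; move=> /(_ Sn Sx0).
by rewrite addnAC [2 + _]addnC => IHx; rewrite leq_add // (leq_mul2l 2 _ 1) dx orbT.
Qed.
End GraphCounting.

(** * Incidence graphs of fat hypertrees *)

Section HypergraphCounting.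
Local Open Scope nat_scope.

Lemma incidence_sym (V : finType) (h : hypergraph V) : symmetric (@incidence V h).
Proof. by case=> [v|i] [w|j]. Qed.

Lemma incidence_irr (V : finType) (h : hypergraph V) : irreflexive (@incidence V h).
Proof. by case. Qed.

Definition vertices_of (V : finType) (e : {mset V}%mset) : {set V} :=
  [set v | v \in e]%SET.

(** Each incidence is seen once from the vertex and once from the hyperedge. Incidence ignores the
    multiplicity of a vertex in [e], hence [#|vertices_of e|] and not [size e]. *)
Lemma incidence_arcs (V : finType) (h : hypergraph V) :
  arcs_in (@incidence V h) [set: V + 'I_(size h)]%SET
    = 2 * \sum_(e <- h) #|vertices_of e|.
Proof.
have sumT (G : finType) (F : G -> nat) : \sum_(u in [set: G]%SET) F u = \sum_u F u.
  by apply: eq_bigl => u; rewrite finset.in_setT.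
rewrite /arcs_in /degree_in sumT big_sumType /=.
under eq_bigr => v _ do
  rewrite sumT big_sumType /= sum_nat_const muln0 add0n.
under [X in _ + X]eq_bigr => j _ do
  rewrite sumT big_sumType /= [X in _ + X]sum_nat_const muln0 addn0.
rewrite exchange_big /= addnn -mul2n; congr (_ * _).
rewrite (big_nth mset0) big_mkord; apply: eq_bigr => j _.
by rewrite -sum1_card [RHS]big_mkcond; apply: eq_bigr => v _; rewrite inE; case: ifP.
Qed.

Lemma card_vertices_of (V : finType) (e : {mset V}%mset) :
  #|vertices_of e| = size (undup e).
Proof.
rewrite -(card_uniqP (undup_uniq e)); apply: eq_card => v.
by rewrite inE mem_undup.
Qed.

Lemma mset_uniqP (V : choiceType) (e : {mset V}%mset) :
  reflect (forall v, e v <= 1) (uniq e).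
Proof.
apply: (iffP idP) => [ue v|e1].
  by rewrite -count_mem_mset count_uniq_mem // leq_b1.
apply: count_mem_uniq => v; rewrite count_mem_mset.
case: (boolP (v \in e)) => [|/mset_eq0P //]; rewrite in_mset.
by have := e1 v; case: (e v) => [|[]].
Qed.

Lemma perm_forget_mult (V : finType) (g : hypergraph V) :
  perm_eq (forget_mult g) (undup g).
Proof. exact: perm_eq_seq_mset. Qed.

Lemma mem_forget_mult (V : finType) (g : hypergraph V) : forget_mult g =i g.
Proof. by move=> e; rewrite (perm_mem (perm_forget_mult g)) mem_undup. Qed.

Lemma hsimple_forget_mult (V : finType) (g : hypergraph V) :
  hsimple (forget_mult g) <-> forall e : {mset V}%mset, e \in g -> uniq e.
Proof.
split=> [sg e eg|ug e].
  by apply/mset_uniqP; have [_] := sg e; apply; rewrite mem_forget_mult.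
split=> [|]; last by rewrite mem_forget_mult => /ug/mset_uniqP.
by rewrite mset_seqE count_uniq_mem ?undup_uniq // leq_b1.
Qed.

Lemma sum_forget_mult (V : finType) (g : hypergraph V) (F : {mset V}%mset -> nat) :
  \sum_(e <- forget_mult g) F e = \sum_(e <- undup g) F e.
Proof. exact/perm_big/perm_forget_mult. Qed.

Lemma sum_vertices_of_le (V : finType) (p : nat) (g : hypergraph V) : uniform p g ->
  \sum_(e <- undup g) #|vertices_of e| <= size (undup g) * p.
Proof.
move=> ug; rewrite -sum1_size big_distrl /= !big_seq leq_sum // => e.
by rewrite mem_undup mul1n => /ug <-; rewrite card_vertices_of size_undup.
Qed.

Lemma sum_vertices_of_eq (V : finType) (p : nat) (g : hypergraph V) : uniform p g ->
  (forall e : {mset V}%mset, e \in g -> uniq e) ->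
  \sum_(e <- undup g) #|vertices_of e| = size (undup g) * p.
Proof.
move=> ug uniqg; rewrite -sum1_size big_distrl /=; apply: eq_big_seq => /= e.
by rewrite mem_undup mul1n => eg; rewrite card_vertices_of undup_id ?ug ?uniqg.
Qed.

Lemma sum_vertices_of_lt (V : finType) (p : nat) (g : hypergraph V) (e : {mset V}%mset) :
  uniform p g -> e \in g -> ~~ uniq e ->
  \sum_(e <- undup g) #|vertices_of e| < size (undup g) * p.
Proof.
move=> ug eg ne; have eu : e \in undup g by rewrite mem_undup.
rewrite -sum1_size big_distrl /= !(big_rem e eu) /= mul1n -addSn leq_add //.
  by rewrite card_vertices_of -(ug e eg) ltn_size_undup.
rewrite !big_seq leq_sum // => f /mem_rem; rewrite mem_undup => /ug <-.
by rewrite card_vertices_of size_undup.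
Qed.

(** * Number of vertices of a hypergraph, fat hypertree or not *)

Section Count.
Variables (V : finType) (p : nat) (g : hypergraph V).
Hypotheses (g_connected : hconnected (forget_mult g)) (g_uniform : uniform p g).

Let sizeF : size (forget_mult g) = size (undup g).
Proof. exact/perm_size/perm_forget_mult. Qed.

Let cardG : #|{: V + 'I_(size (forget_mult g))}| = #|V| + size (undup g).
Proof. by rewrite card_sum card_ord sizeF. Qed.

(** The incidence graph is a tree with [n + q] nodes and [pq] edges, so [n + q = pq + 1]; the two
    inequalities are [lo] and [hi]. *)
Lemma card_fat_hypertree : 0 < p -> fat_hypertree g ->
  #|V| = (size (undup g) * p.-1).+1.
Proof.
move=> p0 [/hsimple_forget_mult ug [con acy]].
have lo := connected_arcs (@incidence_sym _ _) (@incidence_irr _ _) con.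
have hi : arcs_in (@incidence V (forget_mult g)) [set: V + 'I_(size (forget_mult g))]%SET + 2
    <= 2 * #|[set: V + 'I_(size (forget_mult g))]%SET|.
  apply: acyclic_arcs => //; [exact: incidence_sym|exact: incidence_irr|].
  by case: con => + _; rewrite -cardsT card_gt0.
have : 2 * (#|V| + size (undup g)) = 2 * (size (undup g) * p + 1).
  apply/eqP; rewrite eqn_leq; move: lo hi.
  rewrite incidence_arcs sum_forget_mult (sum_vertices_of_eq g_uniform ug) cardsT cardG.
  by rewrite (mulnDr 2 _ 1) => -> ->.
move/eqP; rewrite eqn_mul2l /= => /eqP.
by rewrite -{1}(prednK p0) mulnS addn1 [size _ + _ * _]addnC -addSn => /addIn.
Qed.

(** There are two ways to fail, and each costs one edge. A cycle forces at least [n + q] edges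
    instead of [n + q - 1]; a hyperedge with a repeated vertex leaves strictly fewer than [pq]
    edges. *)
Lemma card_not_fat_hypertree : 0 < p -> ~ fat_hypertree g ->
  #|V| <= size (undup g) * p.-1.
Proof.
move=> p0 nfat; suff : #|V| + size (undup g) <= size (undup g) * p.
  by rewrite -{1}(prednK p0) mulnS [X in _ <= X]addnC leq_add2r.
have le := sum_vertices_of_le g_uniform.
have arcs := incidence_arcs (forget_mult g); rewrite sum_forget_mult in arcs.
have [ug|] := pselect (forall e : {mset V}%mset, e \in g -> uniq e).
  have nacy : ~ acyclic_graph (@incidence V (forget_mult g)).
    by move=> acy; apply: nfat; split; [exact/hsimple_forget_mult|split].
  have [s [us s2]] : exists s, ucycle (@incidence V (forget_mult g)) s /\ 2 < size s.
    apply: contrapT => nex; apply: nacy => s us; rewrite leqNgt; apply/negP => s2.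
    by apply: nex; exists s.
  have := cycle_arcs (@incidence_sym _ _) (@incidence_irr _ _) g_connected us s2.
  by rewrite arcs cardG leq_mul2l /= => /leq_trans; apply.
move=> /existsNP[e /not_implyP[eg /negP ne]].
have lt := sum_vertices_of_lt g_uniform eg ne.
have := connected_arcs (@incidence_sym _ _) (@incidence_irr _ _) g_connected.
rewrite arcs cardG -(mulnDr 2 _ 1) leq_mul2l addn1 /= => /leq_trans; apply.
exact: lt.
Qed.

Lemma degree_undup v : degree g v = \sum_(e <- undup g) g e * (e : {mset V}%mset) v.
Proof.
by rewrite /degree (sum_mset g xpredT) -(perm_big _ (perm_undup_mset _)).
Qed.

(* In a fat hypertree with even degrees, the hyperedges of odd multiplicity would
   span a subgraph of the incidence graph of minimal degree 2. *)
Lemma even_degree_two_divisible : 1 < p -> fat_hypertree g ->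
  (forall v, ~~ odd (degree g v)) -> two_divisible_hypertree g.
Proof.
move=> p1 fat even_deg; split=> // e0 e0g; apply/negP => odd_e0.
have [/hsimple_forget_mult ug [con acy]] := fat.
set k := forget_mult g in con acy.
pose E (j : 'I_(size k)) : {mset V}%mset := nth mset0 k j.
have Eg j : E j \in g by rewrite -mem_forget_mult mem_nth.
(* The hyperedges of odd multiplicity, together with the vertices they contain. *)
pose S : {set V + 'I_(size k)} := [set x | match x with
  | inl v => [exists j, odd (g (E j)) && (v \in E j)]
  | inr j => odd (g (E j)) end]%SET.
have [s] : exists2 s, ucycle (@incidence V k) s & 2 < size s; last first.
  by move=> /acy; rewrite leqNgt => /negP.
apply: (@min_degree2_cycle _ _ S); [exact: incidence_sym|exact: incidence_irr| |].
  apply/set0Pn; have e0k : e0 \in k by rewrite mem_forget_mult.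
  have ik : index e0 k < size k by rewrite index_mem.
  by exists (inr (Ordinal ik)); rewrite inE /E /= nth_index.
case=> [v|j]; rewrite inE; last first.
  (* A hyperedge in [S] has at least two distinct vertices, since [p] is at least 2, and both lie in
     [S]. *)
  move=> oj; have := g_uniform (Eg j); have := ug _ (Eg j).
  case Ej : (E j : seq V) => [|v [|w l]] /=; [by move=> _ p0; rewrite -p0 in p1|
    by move=> _ p0; rewrite -p0 in p1|].
  rewrite inE negb_or => /andP[/andP[vw _] _] _.
  have inS u : u \in E j -> inl u \in S.
    by move=> uj; rewrite inE; apply/existsP; exists j; rewrite oj.
  have vE : v \in E j by rewrite -[_ \in _]/(v \in (E j : seq V)) Ej mem_head.
  have wE : w \in E j by rewrite -[_ \in _]/(w \in (E j : seq V)) Ej !inE eqxx orbT.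
  exact: (@two_le_degree_in _ _ _ _ (inl v) (inl w)) (inS v vE) (inS w wE) vw vE wE.
move=> /existsP[j /andP[oj vj]].
(* Modulo 2 the degree of [v] is the number of odd hyperedges containing it. This number is even, so
   [j] is not the only one. *)
have [i [ij oi vi]] : exists i, [/\ i != j, odd (g (E i)) & v \in E i].
  apply: contrapT => nex; have /negP := even_deg v; apply.
  rewrite degree_undup -sum_forget_mult (big_nth mset0) big_mkord (bigD1 j) //= oddD.
  have E1 i : E i v = (v \in E i).
    have := ug _ (Eg i) => /mset_uniqP/(_ v).
    by rewrite in_mset; case: (E i v) => [|[]].
  rewrite oddM [odd (g _)]oj -/(E j) E1 vj /=.
  rewrite (big_ind (fun n => ~~ odd n)) //.
    by move=> a b; rewrite oddD => /negbTE-> /negbTE->.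
  move=> i ij; rewrite -/(E i) oddM E1; apply/negP => /andP[oi].
  by case: (boolP (v \in E i)) => // vi _; apply: nex; exists i.
apply: (@two_le_degree_in _ _ _ _ (inr j) (inr i)); rewrite ?inE //.
by rewrite eq_sym.
Qed.

End Count.
End HypergraphCounting.

(** Groups the distinct hyperedges by multiplicity, which lies between 1 and [size g]. The limit is
    obtained with one factor per distinct hyperedge. *)
Lemma prod_htype (R : comPzRingType) (V : finType) (g : hypergraph V) (M : nat -> R) :
  \prod_(1 <= r < (size g).+1) M r ^+ htype g r = \prod_(e <- undup g) M (g e).
Proof.
under eq_bigr => r _ do rewrite /htype -iter_mulr_1 -big_const_seq.
rewrite (exchange_big_dep xpredT) //=.
apply: eq_big_seq => e; rewrite mem_undup => eg.
under eq_bigl => r do rewrite eq_sym.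
rewrite big_nat1_eq ltnS -in_mset eg -(count_mem_mset e g).
by rewrite count_size.
Qed.

(** * Quotients of hypergraphs by vertex partitions *)

Section QuotientLemmas.
Local Open Scope nat_scope.
Variables (V : finType) (pi : {set {set V}}).
Hypothesis pi_part : finset.partition pi [set: V]%SET.
Variables (h : hypergraph V).
Let g := hquotient pi_part h.
Let qedge (e : {mset V}%mset) := seq_mset [seq block pi_part v | v <- e].

Let g_perm : perm_eq g [seq qedge e | e <- h].
Proof. exact: perm_eq_seq_mset. Qed.

Lemma hquotient_uniform p : uniform p h -> uniform p g.
Proof.
move=> uh e; rewrite (perm_mem g_perm) => /mapP[f /uh <- ->].
by rewrite (perm_size (perm_eq_seq_mset _)) size_map.
Qed.

(** The quotient keeps every hyperedge with its multiplicity, so degrees add up over a block. When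
    [h] is 2-regular this makes all degrees of the quotient even. *)
Lemma degree_hquotient B :
  degree g B = \sum_(v | block pi_part v == B) degree h v.
Proof.
rewrite /degree (perm_big _ g_perm) big_map /= exchange_big /=.
apply: eq_bigr => e _; rewrite mset_seqE count_map -sum1_count.
under [RHS]eq_bigr => v _ do rewrite -count_mem_mset -sum1_count big_mkcond.
rewrite exchange_big /= big_mkcond; apply: eq_bigr => v _ /=.
case: ifP => vB.
  rewrite (bigD1 v) //= eqxx big1 ?addn0 // => w /andP[_ /negbTE wv].
  by rewrite eq_sym wv.
by rewrite big1 // => w wB; case: eqP => // vw; rewrite vw wB in vB.
Qed.

Lemma block_surj B : exists v, block pi_part v = B.
Proof.
case: B => B Bpi; have /and3P[_ tI n0] := pi_part.
have /set0Pn[v vB] : B != finset.set0 by apply: contraNneq n0 => <-.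
by exists v; apply: val_inj; exact: (finset.def_pblock tI Bpi vB).
Qed.

(** The quotient map induces a surjective homomorphism of incidence graphs, and such a map preserves
    connectedness. *)
Lemma hquotient_connected : hconnected h -> hconnected (forget_mult g).
Proof.
set k := forget_mult g; case=> h0 conh.
have qk (j : 'I_(size h)) : qedge (nth mset0 h j) \in k.
  rewrite mem_forget_mult (perm_mem g_perm); apply/mapP.
  by exists (nth mset0 h j) => //; rewrite mem_nth.
have qi (j : 'I_(size h)) : index (qedge (nth mset0 h j)) k < size k by rewrite index_mem.
(* Hyperedges of [h] with the same image go to the same node, because multiplicities are forgotten
   in [k]. *)
pose f (x : V + 'I_(size h)) : {B | B \in pi} + 'I_(size k) := match x with
  | inl v => inl (block pi_part v) | inr j => inr (Ordinal (qi j)) end.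
have fe x y : incidence x y -> incidence (f x) (f y).
  have inc v (j : 'I_(size h)) : v \in (nth mset0 h j : {mset V}%mset) ->
      block pi_part v \in (nth mset0 k (index (qedge (nth mset0 h j)) k) : {mset _}%mset).
    move=> vj; rewrite nth_index //.
    by rewrite (perm_mem (perm_eq_seq_mset _)) map_f.
  by case: x y => [v|i] [w|j] //=; exact: inc.
have fsurj y : exists x, f x = y.
  case: y => [B|j]; first by have [v <-] := block_surj B; exists (inl v).
  have : nth mset0 k j \in k by rewrite mem_nth.
  rewrite mem_forget_mult (perm_mem g_perm) => /mapP[e eh ej].
  have ih : index e h < size h by rewrite index_mem.
  exists (inr (Ordinal ih)); congr inr; apply: val_inj => /=.
  rewrite nth_index // -ej index_uniq //.
  by rewrite (perm_uniq (perm_forget_mult g)) undup_uniq.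
split; first by have /card_gt0P[x _] := h0; apply/card_gt0P; exists (f x).
move=> y y'; have [x <-] := fsurj y; have [x' <-] := fsurj y'.
have /connectP[s] := conh x x'; elim: s x => [x _ ->|z s IH x /= /andP[xz ps] l].
  exact: connect0.
exact: connect_trans (connect1 (fe _ _ xz)) (IH _ ps l).
Qed.

End QuotientLemmas.

(** * Products of independent random variables *)

Section IndependentProducts.
Import HBNNSimple.
Context (R : realType) (d : measure_display) (Omega : measurableType d).
Variable P : probability Omega R.

Section WeightedIntegral.
Variables (X : {RV P >-> R}) (Z : Omega -> R).
Hypotheses (Z_ge0 : forall w, 0 <= Z w) (mZ : measurable_fun setT Z).

Let mXZ (f : R -> R) : measurable_fun setT f ->
  measurable_fun [set: Omega] (EFin \o (fun w => f (X w) * Z w)).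
Proof.
move=> mf; apply/measurable_EFinP/measurable_funM => //.
exact: measurableT_comp.
Qed.

(** Linearity of the integral, applied to a simple function written as a combination of indicators
    of its level sets. *)
Lemma weighted_integral_nnsfun (h : {nnsfun R >-> R}) :
  (\int[P]_w (h (X w) * Z w)%:E = \sum_(r <- fset_set (range h))
     r%:E * \int[P]_w (\1_(h @^-1` [set r]) (X w) * Z w)%:E)%E.
Proof.
have ge0 (r : R) w : (0 <= (r * (\1_(h @^-1` [set r]) (X w) * Z w))%:E)%E.
  rewrite mulrA EFinM mule_ge0 ?lee_fin //.
  by exact: nnfun_muleindic_ge0.
transitivity (\int[P]_w (\sum_(r <- fset_set (range h))
     (r * (\1_(h @^-1` [set r]) (X w) * Z w))%:E)%E)%E.
  apply: eq_integral => w _; rewrite fimfunE fsbig_finite //= mulr_suml sumEFin.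
  by congr EFin; apply: eq_bigr => r _; rewrite mulrA.
rewrite ge0_integral_sum //; last first.
  move=> r; under eq_fun do rewrite EFinM.
  by apply: measurable_funeM; exact: mXZ.
rewrite big_seq [RHS]big_seq; apply: eq_bigr => r.
rewrite in_fset_set // inE => -[x _ hx].
under eq_integral do rewrite EFinM.
rewrite ge0_integralZl //= ?lee_fin ?mulr_ge0 -?hx //.
  exact: mXZ.
by move=> w _; rewrite lee_fin mulr_ge0.
Qed.

(** Monotone convergence along the increasing simple approximations of [f]. *)
Lemma cvg_weighted_integral (f : R -> R) (mf : measurable_fun setT (EFin \o f)) :
  (forall x, 0 <= f x) ->
  (\int[P]_w (nnsfun_approx measurableT mf n (X w) * Z w)%:E @[n --> \oo] -->
   \int[P]_w (f (X w) * Z w)%:E)%E.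
Proof.
move=> f0; set g := nnsfun_approx measurableT mf.
have -> : (\int[P]_w (f (X w) * Z w)%:E
    = \int[P]_w limn (fun n => (g n (X w) * Z w)%:E))%E.
  apply: eq_integral => w _; apply/esym/cvg_lim => //.
  apply: cvg_EFin; first exact: nearW.
  apply: cvgM; last exact: cvg_cst.
  have := @cvg_nnsfun_approx _ _ _ _ measurableT _ mf (fun x _ => f0 x) (X w) Logic.I.
  by move/fine_cvgP => [].
apply: cvg_monotone_convergence => //.
- by move=> n; exact: mXZ.
- by move=> n w _; rewrite lee_fin mulr_ge0.
- by move=> w _ a b ab; rewrite lee_fin ler_wpM2r //; exact/lefP/nd_nnsfun_approx.
Qed.

End WeightedIntegral.

Lemma fineK_preimage (X : {RV P >-> R}) (A : set R) : measurable A ->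
  ((fine (P (X @^-1` A)))%:E = P (X @^-1` A))%E.
Proof.
move=> mA; rewrite fineK // fin_num_measure //.
by rewrite -[X in measurable X]setTI; exact: measurable_funPT.
Qed.

Lemma integral_indic_comp (X : {RV P >-> R}) (A : set R) : measurable A ->
  (\int[P]_w (\1_A (X w))%:E = P (X @^-1` A))%E.
Proof.
move=> mA; rewrite (_ : (fun w => _) = EFin \o \1_(X @^-1` A)).
  rewrite integral_indic ?setIT //.
  by rewrite -[X in measurable X]setTI; exact: measurable_funPT.
by apply/funext => w /=; rewrite !indicE.
Qed.

(** A product formula known for indicators extends to simple functions by linearity and to
    nonnegative measurable functions by monotone convergence. The hypothesis at [A = setT]
    identifies [c] as the integral of [Z]. *)
Lemma ge0_integral_indep (X : {RV P >-> R}) (Z : Omega -> R) (c : R) (f : R -> R) :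
  (forall w, 0 <= Z w) -> measurable_fun setT Z ->
  (forall A, measurable A ->
    \int[P]_w (\1_A (X w) * Z w)%:E = P (X @^-1` A) * c%:E)%E ->
  (forall x, 0 <= f x) -> measurable_fun setT f ->
  (\int[P]_w (f (X w) * Z w)%:E = \int[P]_w (f (X w))%:E * c%:E)%E.
Proof.
move=> Z0 mZ indep f0 mf; have emf : measurable_fun setT (EFin \o f).
  exact/measurable_EFinP.
(* With the constant weight 1 the same two lemmas also treat the unweighted integral on the
   right. *)
pose One (w : Omega) : R := 1.
have One0 w : 0 <= One w by exact: ler01.
have mOne : measurable_fun setT One by exact: measurable_cst.
have int1 g : (\int[P]_w (g (X w))%:E = \int[P]_w (g (X w) * One w)%:E)%E.
  by apply: eq_integral => w _; rewrite mulr1.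
have cvgZ := cvg_weighted_integral (X := X) Z0 mZ emf f0.
have cvg1 := cvg_weighted_integral (X := X) One0 mOne emf f0.
rewrite (int1 f); apply: (cvg_unique _ cvgZ) => //.
apply: cvg_trans (cvgeZr (isT : c%:E \is a fin_num) cvg1).
apply: near_eq_cvg; near=> n.
set h := nnsfun_approx _ _ _.
rewrite !weighted_integral_nnsfun //.
have mh r : measurable (h @^-1` [set r]) by [].
under eq_bigr => r _ do
  rewrite -(int1 (\1_(h @^-1` [set r]))) integral_indic_comp // -fineK_preimage // -EFinM.
under [RHS]eq_bigr => r _ do rewrite indep // -fineK_preimage // -!EFinM.
by rewrite !sumEFin -EFinM mulr_suml; under eq_bigr do rewrite -mulrA.
Unshelve. all: by end_near. Qed.

Section Family.
Variables (I : finType) (D : {set I}) (X : I -> {RV P >-> R}).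
Hypothesis indepX : mutually_independent D X.

Let prod_indic (A : I -> set R) (s : seq I) w :
  \prod_(j <- s) (\1_(A j) (X j w) : R) =
  \1_(\bigcap_(j in [set` s]) (X j @^-1` A j)) w.
Proof.
rewrite indicE; have [al|nall] := boolP (all (fun j => X j w \in A j) s).
  rewrite mem_set ?big1_seq // => [j /andP[_ js]|j js].
    by rewrite indicE (allP al).
  by have := allP al j js; rewrite inE.
rewrite memNset; last first.
  move=> inA; move/negP: nall; apply; apply/allP => j js.
  by rewrite inE; exact: inA.
have /allPn[j js nj] := nall.
by rewrite (big_rem j js) /= indicE (negbTE nj) mul0r.
Qed.

(* Independence is the case [s = [::]]; the indicator factors indexed by [t] let
   the other factors be generalized one at a time by [ge0_integral_indep]. *)
Lemma ge0_integral_prod_indep (f : I -> R -> R) (s t : seq I) (A : I -> set R) :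
  (forall i x, 0 <= f i x) -> (forall i, measurable_fun setT (f i)) ->
  (forall i, i \in s -> \int[P]_w (f i (X i w))%:E < +oo)%E ->
  (forall i, measurable (A i)) -> uniq (s ++ t) -> {subset s ++ t <= D} ->
  (\int[P]_w (\prod_(i <- s) f i (X i w) * \prod_(j <- t) \1_(A j) (X j w))%:E =
  (\prod_(i <- s) fine (\int[P]_w (f i (X i w))%:E)
    * \prod_(j <- t) fine (P (X j @^-1` A j)))%:E)%E.
Proof.
move=> f0 mf; elim: s t A => [t A _ mA ut tD|i s IH t A intf mA].
  rewrite big_nil mul1r; under eq_integral do rewrite big_nil mul1r prod_indic.
  have tE : [set` t] = [set` [set j in t]%SET].
    by apply/seteqP; split => j /=; rewrite inE.
  rewrite integral_indic ?setIT //; last first.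
    apply: fin_bigcap_measurable; first exact: finite_finset.
    by move=> j _; rewrite -[X in measurable X]setTI; exact: measurable_funPT.
  rewrite tE; transitivity (\prod_(j in [set j in t]%SET) P (X j @^-1` A j))%E.
    by apply: indepX => //; apply/fintype.subsetP => j; rewrite inE; exact: tD.
  rewrite -prodEFin [RHS]big_uniq //=; under [RHS]eq_bigr do rewrite fineK_preimage //.
  by apply: eq_bigl => j; rewrite inE.
rewrite cat_cons => /= /andP[ist ust] stD.
have iD : i \in D by apply: stD; rewrite inE eqxx.
have stD' : {subset s ++ t <= D} by move=> j jst; apply: stD; rewrite inE jst orbT.
have intf' j : j \in s -> (\int[P]_w (f j (X j w))%:E < +oo)%E.
  by move=> js; apply: intf; rewrite inE js orbT.
pose Z w := \prod_(j <- s) f j (X j w) * \prod_(j <- t) \1_(A j) (X j w).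
pose c := \prod_(j <- s) fine (\int[P]_w (f j (X j w))%:E)
    * \prod_(j <- t) fine (P (X j @^-1` A j)).
under eq_integral do rewrite big_cons -mulrA -/(Z _).
rewrite big_cons -mulrA -/c EFinM fineK; last first.
  rewrite ge0_fin_numE ?intf ?mem_head //.
  by apply: integral_ge0 => w _; rewrite lee_fin.
apply: (@ge0_integral_indep (X i) Z c (f i)) => //.
- by move=> w; rewrite mulr_ge0 // prodr_ge0.
- apply: measurable_funM; apply: measurable_prod => j _.
    exact: measurableT_comp.
  by apply: measurableT_comp => //; exact: measurable_indic.
- move=> B mB.
  (* To test against the indicator of [B], the index [i] moves from [s] to [t] with [B] as its set,
     and the induction hypothesis applies. *)
  pose A' j := if j == i then B else A j.
  have mA' j : measurable (A' j) by rewrite /A'; case: ifP.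
  have A't j : j \in t -> A' j = A j.
    move=> jt; rewrite /A'; case: eqP => // ji.
    by move: ist; rewrite mem_cat -ji jt orbT.
  have := IH (i :: t) A' intf' mA'.
  have perm_ist : perm_eq (s ++ i :: t) (i :: s ++ t).
    by rewrite perm_catC /= perm_cons perm_catC.
  rewrite (perm_uniq perm_ist) /= ist ust => /(_ isT) IH'.
  have {}IH' := IH' (fun j jst => stD j (etrans (esym (perm_mem perm_ist j)) jst)).
  have A't_prod (F : I -> set R -> R) : \prod_(j <- t) F j (A' j) = \prod_(j <- t) F j (A j).
    by apply: eq_big_seq => j jt; rewrite A't.
  have A'i : A' i = B by rewrite /A' eqxx.
  move: IH'; rewrite big_cons A'i (A't_prod (fun j A => fine (P (X j @^-1` A)))).
  rewrite mulrCA EFinM fineK_preimage // -/c => <-.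
  apply: eq_integral => w _; rewrite big_cons A'i.
  by rewrite (A't_prod (fun j A => \1_A (X j w))) mulrCA.
Qed.

(* The sign decomposition [f = f^+ - f^-] turns the product into a signed sum of
   products of nonnegative functions. *)
Lemma integral_prod_indep (f : I -> R -> R) (J : {set I}) : J \subset D ->
  (forall i, measurable_fun setT (f i)) ->
  (forall i, i \in J -> P.-integrable setT (fun w => (f i (X i w))%:E)) ->
  P.-integrable setT (fun w => (\prod_(i in J) f i (X i w))%:E) /\
  (\int[P]_w (\prod_(i in J) f i (X i w))%:E =
   (\prod_(i in J) fine (\int[P]_w (f i (X i w))%:E))%:E)%E.
Proof.
move=> /fintype.subsetP JD mf intf.
(* [u false] is the positive part and [u true] the negative part of [f]. *)
pose u (b : bool) i (x : R) : R := Num.max ((-1) ^+ b * f i x) 0.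
have mu_ b i : measurable_fun setT (u b i).
  apply: measurable_maxr => //; apply: measurable_funM => //.
have u0 b i x : 0 <= u b i x by rewrite le_max lexx orbT.
have fu i x : f i x = \sum_(b : bool) (-1) ^+ b * u b i x.
  rewrite big_bool /u /= expr0 expr1 !mul1r !mulN1r.
  case: (leP 0 (f i x)) => f0.
    by rewrite max_r ?oppr_le0 // oppr0 add0r.
  by rewrite max_l ?oppr_ge0 ?(ltW f0) // opprK addr0.
have iu b i : i \in J -> P.-integrable setT (fun w => (u b i (X i w))%:E).
  move=> iJ; apply: le_integrable (intf i iJ) => //.
    by apply/measurable_EFinP; exact: measurableT_comp.
  move=> w _ /=; rewrite lee_fin ger0_norm //; rewrite /u ge_max normr_ge0 andbT.
  by rewrite (le_trans (ler_norm _)) // normrM normrX normrN1 expr1n mul1r.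
pose m b i := fine (\int[P]_w (u b i (X i w))%:E)%E.
pose sg (s : {ffun I -> bool}) : R := \prod_(i in J) (-1) ^+ s i.
pose K (s : {ffun I -> bool}) w : R := \prod_(i in J) u (s i) i (X i w).
have K0 s w : 0 <= K s w by rewrite prodr_ge0.
have intK s : (\int[P]_w (K s w)%:E = (\prod_(i in J) m (s i) i)%:E)%E.
  have := @ge0_integral_prod_indep (fun i => u (s i) i) (enum J) [::] (fun=> setT).
  under eq_integral do rewrite big_nil mulr1 big_enum.
  rewrite big_nil mulr1 big_enum /=; apply => //.
  - by move=> i; rewrite mem_enum => /(iu (s i)) ius; exact: integrable_lty.
  - by rewrite cats0 enum_uniq.
  - by move=> i; rewrite cats0 mem_enum; exact: JD.
have iK s : P.-integrable setT (fun w => (K s w)%:E).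
  apply/integrableP; split.
    apply/measurable_EFinP; rewrite /K.
    under eq_fun do rewrite -big_enum.
    apply: measurable_prod => i _; exact: measurableT_comp.
  under eq_integral do rewrite /= ger0_norm //.
  by rewrite intK ltry.
have isgK s : P.-integrable setT (fun w => (sg s * K s w)%:E).
  by under eq_fun do rewrite EFinM; exact: integrableZl.
have intsgK s : (\int[P]_w (sg s * K s w)%:E = (sg s * \prod_(i in J) m (s i) i)%:E)%E.
  by under eq_integral do rewrite EFinM; rewrite integralZl // intK -EFinM.
(* Distributing the product gives one term per choice of signs on [J]; [pfamily] fixes the choice to
   [true] outside [J] so that each is counted once. *)
have expand (g : I -> bool -> R) : \prod_(i in J) \sum_(b : bool) (-1) ^+ b * g i b =
    \sum_(s in pfamily true (mem J) (fun=> xpredT)) sg s * \prod_(i in J) g i (s i).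
  rewrite (big_distr_big_dep true); apply: eq_bigr => s _.
  by rewrite -big_split.
have fE w : (\prod_(i in J) f i (X i w))%:E =
    (\sum_(s in pfamily true (mem J) (fun=> xpredT)) (sg s * K s w)%:E)%E.
  rewrite sumEFin -(expand (fun i b => u b i (X i w))); congr EFin.
  by apply: eq_bigr => i _; rewrite fu.
under eq_fun do rewrite fE.
split; first exact: integrable_sum.
rewrite integral_sum //.
rewrite (eq_bigr _ (fun s _ => intsgK s)) sumEFin -(expand (fun i b => m b i)); congr EFin.
apply: eq_bigr => i iJ.
apply: EFin_inj; rewrite fineK; last exact: integrable_fin_num (intf i iJ).
under [RHS]eq_integral do rewrite fu -sumEFin.
rewrite integral_sum //; last first.
  by move=> b; under eq_fun do rewrite EFinM; apply: integrableZl => //; exact: iu.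
rewrite -sumEFin; apply: eq_bigr => b _.
under [RHS]eq_integral do rewrite EFinM.
rewrite integralZl //; last exact: iu.
by rewrite EFinM fineK //; exact: integrable_fin_num (iu b i iJ).
Qed.

End Family.
End IndependentProducts.

(** Reindexes the factors by labels [e] sent injectively to indices, so that distinct hyperedges can
    label the entries of a tensor. *)
Lemma integral_prod_indep_seq (R : realType) (d : measure_display)
    (Omega : measurableType d) (P : probability Omega R) (I : finType) (D : {set I})
    (X : I -> {RV P >-> R}) (E : eqType) (s : seq E) (tau : E -> I) (f : E -> R -> R) :
  mutually_independent D X -> uniq s -> {in s &, injective tau} ->
  (forall e, e \in s -> tau e \in D) -> (forall e, measurable_fun setT (f e)) ->
  (forall e, e \in s -> P.-integrable setT (fun w => (f e (X (tau e) w))%:E)) ->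
  P.-integrable setT (fun w => (\prod_(e <- s) f e (X (tau e) w))%:E) /\
  (\int[P]_w (\prod_(e <- s) f e (X (tau e) w))%:E =
   (\prod_(e <- s) fine (\int[P]_w (f e (X (tau e) w))%:E))%:E)%E.
Proof.
move=> indep us tau_inj tauD mf intf; case: s us tau_inj tauD intf => [_ _ _ _|e0 s].
  under eq_fun do rewrite big_nil; rewrite big_nil; split.
    exact: finite_measure_integrable_cst.
  by rewrite integral_cst //= probability_setT mule1.
set r := e0 :: s => ur tau_inj tauD intf.
pose J : {set I} := [set i in [seq tau e | e <- r]]%SET.
(* A left inverse of [tau] on [r]. The default [e0] requires a nonempty list, which is why the empty
   one was treated apart. *)
pose idx i := nth e0 r (find (fun e => tau e == i) r).
have idxK e : e \in r -> idx (tau e) = e.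
  move=> er; have hase : has (fun e' => tau e' == tau e) r by apply/hasP; exists e.
  apply: tau_inj => //; first by rewrite mem_nth // -has_find.
  exact/eqP/(nth_find e0 hase).
have prodE (F : E -> I -> R) :
    \prod_(e <- r) F e (tau e) = \prod_(i in J) F (idx i) i.
  transitivity (\prod_(e <- r) F (idx (tau e)) (tau e)).
    by apply: eq_big_seq => e er; rewrite idxK.
  rewrite -(big_map tau xpredT (fun i => F (idx i) i)) big_uniq ?map_inj_in_uniq //=.
  by apply: eq_bigl => i; rewrite [RHS]inE.
have JD : J \subset D.
  by apply/fintype.subsetP => i; rewrite inE => /mapP[e er ->]; exact: tauD.
have [] := integral_prod_indep indep (f := fun i => f (idx i)) JD.
- by move=> i; exact: mf.
- by move=> i; rewrite inE => /mapP[e er ->]; rewrite idxK //; exact: intf.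
rewrite (prodE (fun e i => fine (\int[P]_w (f e (X i w))%:E)%E)).
by under eq_fun do rewrite -(prodE (fun e i => f e (X i _))).
Qed.

(** * Moments of heavy-Wigner tensors *)

(** Multiplied by an even power of [x], this bounds odd powers by the two neighbouring even ones. *)
Lemma normr_le1Dsqr (R : realDomainType) (x : R) : `|x| <= 1 + x ^+ 2.
Proof.
rewrite -[x ^+ 2]ger0_norm ?sqr_ge0 // normrX.
have [x1|x1] := leP `|x| 1; first by rewrite (le_trans x1) // lerDl exprn_ge0.
by rewrite expr2 (le_trans (ler_peMl _ (ltW x1))) // lerDr.
Qed.

Section Moments.
Variables (R : realType) (p : nat) (d : nat -> measure_display)
  (Omega : forall N, measurableType (d N)) (P : forall N, probability (Omega N) R)
  (T : forall N, p.-tuple 'I_N -> {RV (P N) >-> R}) (M : nat -> R).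
Hypothesis hwT : heavy_wigner T M.

(** Since [fine] sends infinite values to 0, the bounds on moments are stated together with
    integrability. *)
Definition moment N k (i : p.-tuple 'I_N) : R :=
  fine (\int[P N]_w (T i w ^+ k)%:E)%E.

Let mTk N k (i : p.-tuple 'I_N) :
  measurable_fun setT (EFin \o (fun w => T i w ^+ k)).
Proof. exact/measurable_EFinP/measurable_funX. Qed.

(** An even power is nonnegative, so the bound on its scaled integral makes it finite, which gives
    integrability. *)
Lemma even_moment_bounded k : (2 <= k)%N -> ~~ odd k -> exists C : R,
  \forall N \near \oo, forall i : p.-tuple 'I_N,
    (P N).-integrable setT (fun w => (T i w ^+ k)%:E) /\
    `|N%:R ^+ p.-1 * moment k i| <= C.
Proof.
move=> k2 ek; have [C hC] := hw_bounded hwT k2.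
exists C; near=> N => i.
have N0 : (0 < N)%N by near: N; exact: nbhs_infty_gt.
have Np : 0 < N%:R ^+ p.-1 :> R by rewrite exprn_gt0 // ltr0n.
have X0 w : 0 <= T i w ^+ k by rewrite exprn_even_ge0.
have int0 : (0 <= \int[P N]_w (T i w ^+ k)%:E)%E.
  by apply: integral_ge0 => w _; rewrite lee_fin.
have le : ((N%:R ^+ p.-1)%:E * \int[P N]_w (T i w ^+ k)%:E <= C%:E)%E.
  have -> : ((N%:R ^+ p.-1)%:E * \int[P N]_w (T i w ^+ k)%:E
      = scaled_moment (@T N) k i)%E by rewrite /scaled_moment unlock.
  apply: (@le_trans _ _
    (ereal_sup [set scaled_moment (@T N) k i | i in [set: p.-tuple 'I_N]])).
    by apply: ereal_sup_ubound; exists i.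
  by apply: le_trans (lee_abs _) _; near: N.
have fin : (\int[P N]_w (T i w ^+ k)%:E < +oo)%E.
  rewrite ltNge leye_eq; apply/negP => /eqP E; move: le.
  by rewrite E gt0_muley ?lte_fin // leye_eq.
have fn : (\int[P N]_w (T i w ^+ k)%:E)%E \is a fin_num by rewrite ge0_fin_numE.
split.
  apply/integrableP; split; first exact: mTk.
  by under eq_integral do rewrite gee0_abs ?lee_fin //.
rewrite ger0_norm ?mulr_ge0 ?fine_ge0 ?(ltW Np) //.
by rewrite -lee_fin EFinM fineK.
Unshelve. all: by end_near. Qed.

(** An odd power with [k] at least 3 is dominated by the sum of the powers [k - 1] and [k + 1], both
    even. *)
Lemma moment_bounded k : (1 <= k)%N -> exists C : R,
  \forall N \near \oo, forall i : p.-tuple 'I_N,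
    (P N).-integrable setT (fun w => (T i w ^+ k)%:E) /\
    `|N%:R ^+ p.-1 * moment k i| <= C.
Proof.
move=> k1; have [ok|ek] := boolP (odd k); last first.
  by apply: even_moment_bounded => //; case: k k1 ek => [|[]].
(* For [k = 1] the lower neighbour is the power 0, whose scaled moment [N^(p-1)] is unbounded as
   soon as [p] is at least 2. Centering gives the value 0, and the second moment gives
   integrability. *)
have [k_1|kn1] := eqVneq k 1%N.
  have [C hC] := even_moment_bounded (leqnn 2) isT.
  exists 0; rewrite k_1; near=> N => i.
  have [int2 _] : (P N).-integrable setT (fun w => (T i w ^+ 2)%:E) /\
    `|N%:R ^+ p.-1 * moment 2 i| <= C by move: i; near: N.
  split.
    apply: (@le_integrable _ _ _ _ _ _ _ (fun w => (1 + T i w ^+ 2)%:E)) => //.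
    - exact: mTk.
    - move=> w _; rewrite !abse_EFin lee_fin expr1.
      by rewrite [leRHS]ger0_norm ?addr_ge0 ?sqr_ge0 // normr_le1Dsqr.
    - under eq_fun do rewrite EFinD.
      by apply: integrableD => //; exact: finite_measure_integrable_cst.
  rewrite /moment; under eq_integral do rewrite expr1.
  have := hw_centered hwT i; rewrite unlock => ->.
  by rewrite mulr0 normr0.
have k3 : (2 <= k.-1)%N by case: k k1 ok kn1 => [|[|[]]].
have ek1 : ~~ odd k.-1 by case: k k1 ok {kn1 k3} => //= k _; rewrite negbK.
have [C hC] := even_moment_bounded k3 ek1.
have ek2 : ~~ odd k.+1 by rewrite /= ok.
have [C' hC'] := even_moment_bounded (k := k.+1) k1 ek2.
exists (C + C'); near=> N => i.
have [int1 le1] : (P N).-integrable setT (fun w => (T i w ^+ k.-1)%:E) /\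
    `|N%:R ^+ p.-1 * moment k.-1 i| <= C by move: i; near: N.
have [int2 le2] : (P N).-integrable setT (fun w => (T i w ^+ k.+1)%:E) /\
    `|N%:R ^+ p.-1 * moment k.+1 i| <= C' by move: i {int1 le1}; near: N.
have Npos : 0 <= N%:R ^+ p.-1 :> R by rewrite exprn_ge0.
have bnd x : `|x ^+ k| <= x ^+ k.-1 + x ^+ k.+1 :> R.
  have -> : x ^+ k.+1 = x ^+ 2 * x ^+ k.-1 by rewrite -exprD add2n prednK // ltnW.
  have -> : x ^+ k = x * x ^+ k.-1 by rewrite -exprS prednK.
  rewrite normrM -[X in X + _]mul1r -mulrDl.
  rewrite [ `|_ ^+ _| ]ger0_norm ?exprn_even_ge0 //.
  by rewrite ler_wpM2r ?exprn_even_ge0 ?normr_le1Dsqr.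
have intD : (P N).-integrable setT (fun w => (T i w ^+ k.-1 + T i w ^+ k.+1)%:E).
  by under eq_fun do rewrite EFinD; exact: integrableD.
have intk : (P N).-integrable setT (fun w => (T i w ^+ k)%:E).
  apply: le_integrable intD => //; first exact: mTk.
  by move=> w _; rewrite !abse_EFin lee_fin (le_trans (bnd _)) ?ler_norm.
split => //.
rewrite normrM (ger0_norm Npos).
have : `|moment k i| <= moment k.-1 i + moment k.+1 i.
  rewrite -lee_fin EFinD /moment -abse_EFin !fineK ?integrable_fin_num //.
  rewrite -integralD //; apply: le_trans (le_abse_integral _ _ _) _ => //.
    exact: mTk.
  apply: ge0_le_integral => //.
  - by apply: measurableT_comp => //; exact: mTk.
  - by under eq_fun do rewrite -EFinD; case/integrableP: intD.
  - by move=> w _; rewrite abse_EFin -EFinD lee_fin.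
move=> /(ler_wpM2l Npos) /le_trans; apply.
rewrite mulrDr lerD //; exact: le_trans (ler_norm _) _.
Unshelve. all: by end_near. Qed.

Lemma moment_cvg k (eps : R) : (2 <= k)%N -> 0 < eps ->
  \forall N \near \oo, forall i : p.-tuple 'I_N,
    sorted ltn [seq val j | j <- i] -> `|N%:R ^+ p.-1 * moment k i - M k| <= eps.
Proof.
move=> k2 e0; have [C hC] := moment_bounded (ltnW k2).
near=> N => i si.
have [intk _] : (P N).-integrable setT (fun w => (T i w ^+ k)%:E) /\
    `|N%:R ^+ p.-1 * moment k i| <= C by move: i {si}; near: N.
have : (`| scaled_moment (@T N) k i - (M k)%:E | <= eps%:E)%E.
  by move: i si {intk}; near: N; exact: (hw_moments hwT).
by rewrite /scaled_moment unlock -[X in (_ * X)%E]fineK ?integrable_fin_num.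
Unshelve. all: by end_near. Qed.

End Moments.

(** * Entries of a symmetric tensor along hyperedges *)

Section EdgeTuples.
Variables (p N : nat) (W : finType) (v0 : W).
Implicit Types (phi : W -> 'I_N) (e : {mset W}%mset).

Let le_ord : rel 'I_N := relpre val leq.

(* The default [v0] only serves to inhabit ['I_N]. *)
Definition edge_tuple phi e : p.-tuple 'I_N :=
  insubd (nseq_tuple p (phi v0)) (sort le_ord [seq phi v | v <- e]).

Lemma val_edge_tuple phi e : size e = p ->
  edge_tuple phi e = sort le_ord [seq phi v | v <- e] :> seq 'I_N.
Proof.
move=> se; rewrite /edge_tuple insubdK //.
by rewrite -topredE /= size_sort size_map se.
Qed.

Lemma edge_tuple_perm phi e : size e = p ->
  perm_eq [seq phi v | v <- e] (edge_tuple phi e).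
Proof. by move=> se; rewrite val_edge_tuple // perm_sym perm_sort. Qed.

Lemma edge_tuple_sorted phi e : size e = p ->
  sorted leq [seq val j | j <- edge_tuple phi e].
Proof.
move=> se; rewrite sorted_map val_edge_tuple //.
by apply: sort_sorted => i j; exact: leq_total.
Qed.

Lemma edge_tuple_ltn_sorted phi e : injective phi -> size e = p -> uniq e ->
  sorted ltn [seq val j | j <- edge_tuple phi e].
Proof.
move=> phi_inj se ue; rewrite ltn_sorted_uniq_leq edge_tuple_sorted // andbT.
rewrite map_inj_uniq; last exact: val_inj.
by rewrite -(perm_uniq (edge_tuple_perm phi se)) map_inj_uniq.
Qed.

(** Sorting loses only the order of the labels, and an injective labelling recovers the vertices
    from them. Distinct hyperedges thus select distinct independent entries. *)
Lemma edge_tuple_inj phi e e' : injective phi -> size e = p -> size e' = p ->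
  edge_tuple phi e = edge_tuple phi e' -> e = e'.
Proof.
move=> phi_inj se se' ee'; have := edge_tuple_perm phi se.
rewrite ee' perm_sym => /(perm_trans (edge_tuple_perm phi se')).
move=> /(perm_map_inj phi_inj) /seq.permP pe.
by apply/msetP => v; rewrite -!count_mem_mset pe.
Qed.

(** Symmetry replaces the arbitrary listing of [e] by the sorted tuple, the representative for which
    independence is assumed. *)
Lemma edge_entryE (R : realType) (t : tensor R p N) phi e :
  (forall (i : p.-tuple 'I_N) (s : 'S_p), t [tuple tnth i (s k) | k < p] = t i) ->
  size e = p -> edge_entry t phi e = t (edge_tuple phi e).
Proof.
move=> tsym se; rewrite /edge_entry.
have sz : size [seq phi v | v <- e] == p by rewrite size_map se.
rewrite insubT /=; have /tuple_permP[s es] := edge_tuple_perm phi se.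
by rewrite -[RHS](tsym _ s); congr t; apply: val_inj; rewrite /= es.
Qed.

End EdgeTuples.

Lemma prod_mset_exp (R : comPzRingType) (E : choiceType) (g : {mset E}%mset) (F : E -> R) :
  \prod_(e <- g) F e = \prod_(e <- undup g) F e ^+ g e.
Proof.
by rewrite -big_undup_iterop_count; apply: eq_bigr => e _; rewrite count_mem_mset.
Qed.

(** * Expectation of the injective trace *)

Section ExpectedTrace.
Variables (R : realType) (p : nat) (d : nat -> measure_display)
  (Omega : forall N, measurableType (d N)) (P : forall N, probability (Omega N) R)
  (T : forall N, p.-tuple 'I_N -> {RV (P N) >-> R}) (M : nat -> R).
Hypothesis hwT : heavy_wigner T M.
Variables (W : finType) (v0 : W) (g : hypergraph W).
Hypothesis g_uniform : uniform p g.

Definition edge_moments N (phi : W -> 'I_N) : R :=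
  \prod_(e <- undup g) moment T (g e) (edge_tuple p v0 phi e).

(** For an injective labelling the repeated hyperedges are gathered into powers of distinct
    independent entries, so the expectation factors; linearity does the rest. *)
Lemma expectation_tr0 N :
  (forall e, e \in g -> forall i,
    (P N).-integrable setT (fun w => (T i w ^+ g e)%:E)) ->
  ('E_(P N)[fun w => tr0 g (fun i : p.-tuple 'I_N => T i w)] =
  (N%:R^-1 * \sum_(phi : {ffun W -> 'I_N} | injectiveb phi) edge_moments phi)%:E)%E.
Proof.
move=> intT; rewrite unlock.
(* The value 0 at labellings that are not injective turns the sum into one over all functions. *)
pose h (phi : {ffun W -> 'I_N}) w : R := if injectiveb phi then
  \prod_(e <- undup g) T (edge_tuple p v0 phi e) w ^+ g e else 0.
have hE phi : (P N).-integrable setT (fun w => (h phi w)%:E) /\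
    (\int[P N]_w (h phi w)%:E =
      (if injectiveb phi then edge_moments phi else 0)%:E)%E.
  rewrite /h; case: injectiveP => [phi_inj|_]; last first.
    by split; [exact: integrable0|rewrite integral0].
  apply: (@integral_prod_indep_seq _ _ _ _ _ _ _ _ (undup g) (edge_tuple p v0 phi)
    (fun e x => x ^+ g e) (hw_independent hwT (N:=N))).
  - exact: undup_uniq.
  - move=> e e'; rewrite !mem_undup => eg e'g; apply: edge_tuple_inj => //.
      exact: g_uniform.
    exact: g_uniform.
  - move=> e; rewrite mem_undup inE => eg.
    by apply: edge_tuple_sorted; exact: g_uniform.
  - by move=> e; exact: measurable_funX.
  - by move=> e; rewrite mem_undup => eg; exact: intT.
transitivity (\int[P N]_w (N%:R^-1%:E * \sum_phi (h phi w)%:E))%E.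
  apply: eq_integral => w _; rewrite sumEFin -EFinM /tr0 /Tr0; congr (_ * _)%:E.
  rewrite big_mkcond; apply: eq_bigr => phi _; rewrite /h; case: ifP => // _.
  rewrite prod_mset_exp; apply: eq_big_seq => e; rewrite mem_undup => eg.
  congr (_ ^+ _); apply: edge_entryE; last exact: g_uniform.
  by move=> i s; exact: (hw_symmetric hwT).
have hi phi := (hE phi).1.
rewrite integralZl //; last exact: integrable_sum.
rewrite integral_sum // (eq_bigr _ (fun phi _ => (hE phi).2)) sumEFin -EFinM.
by rewrite -big_mkcond.
Qed.

End ExpectedTrace.

(** * Limits *)

Section UniformLimits.
Variables (R : realType) (Phi : nat -> Type) (Q : forall N, Phi N -> Prop).
Variables (E : eqType) (b : E -> forall N, Phi N -> R).

(** The labellings range over a type depending on [N], so boundedness and convergence are meant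
    uniformly in [phi]. Here [Q] will be injectivity. *)
Lemma prod_uniform_bounded (s : seq E) :
  (forall e, e \in s -> exists C,
    \forall N \near \oo, forall phi, @Q N phi -> `|b e phi| <= C) ->
  exists C, \forall N \near \oo, forall phi, @Q N phi -> `|\prod_(e <- s) b e phi| <= C.
Proof.
elim: s => [_|e s IH bnd].
  by exists 1; near=> N => phi _; rewrite big_nil normr1.
have [C hC] := bnd e (mem_head _ _).
have [|C' hC'] := IH; first by move=> f fs; apply: bnd; rewrite inE fs orbT.
exists (C * C'); near=> N => phi Qphi; rewrite big_cons normrM ler_pM //.
  by move: phi Qphi; near: N.
by move: phi Qphi; near: N.
Unshelve. all: by end_near. Qed.

Lemma prod_uniform_cvg (s : seq E) (L : E -> R) :
  (forall e, e \in s -> forall eps, 0 < eps ->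
    \forall N \near \oo, forall phi, @Q N phi -> `|b e phi - L e| <= eps) ->
  forall eps, 0 < eps ->
    \forall N \near \oo, forall phi, @Q N phi ->
      `|\prod_(e <- s) b e phi - \prod_(e <- s) L e| <= eps.
Proof.
elim: s => [_ eps e0|e s IH cvg_b eps e0].
  by near=> N => phi _; rewrite !big_nil subrr normr0 ltW.
pose l := L e; pose m := \prod_(f <- s) L f.
(* As [delta] is at most 1, the three terms of the expansion below are at most [delta], [|l| delta]
   and [|m| delta], with sum [delta * K], which is at most [eps]. *)
pose K := 1 + `|l| + `|m|; have K0 : 0 < K by rewrite ltr_wpDr // ltr_wpDr.
pose delta := Num.min 1 (eps / K).
have d0 : 0 < delta by rewrite lt_min ltr01 divr_gt0.
near=> N => phi Qphi; rewrite !big_cons -/l -/m.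
set x := b e phi; set y := \prod_(f <- s) b f phi.
have xl : `|x - l| <= delta.
  by rewrite /x /l; move: phi Qphi {x y}; near: N; apply: cvg_b; rewrite ?mem_head.
have ym : `|y - m| <= delta.
  rewrite /y /m; move: phi Qphi {x y xl}; near: N; apply: IH => // f fs.
  by apply: cvg_b; rewrite inE fs orbT.
have -> : x * y - l * m = (x - l) * (y - m) + l * (y - m) + m * (x - l).
  by ring.
apply: (@le_trans _ _ (delta * K)); last first.
  by rewrite -ler_pdivlMr // ge_min lexx orbT.
rewrite [leRHS]mulrDr [X in _ <= X + _]mulrDr mulr1.
apply: le_trans (ler_normD _ _) _; apply: lerD; last first.
  by rewrite normrM mulrC ler_wpM2r.
apply: le_trans (ler_normD _ _) _; apply: lerD; last first.
  by rewrite normrM mulrC ler_wpM2r.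
rewrite normrM; apply: le_trans (ler_pM _ _ xl ym) _ => //.
by rewrite ler_piMr ?ge_min ?lexx ?(ltW d0).
Unshelve. all: by end_near. Qed.

End UniformLimits.

(** * Normalized sums over injective labellings *)

Section InjectiveSums.
Variables (R : realType) (W : finType) (B : forall N, {ffun W -> 'I_N} -> R).

(** The proportion of injective labellings tends to 1: passing from [n] to [n + 1] multiplies it by
    [1 - n/N]. *)
Lemma cvg_ffact n : (N ^_ n)%:R / N%:R ^+ n @[N --> \oo] --> (1 : R).
Proof.
elim: n => [|n IH].
  rewrite (_ : (fun N : nat => _) = fun=> 1) //; first exact: cvg_cst.
  by apply/funext => N; rewrite ffactn0 expr0 divr1.
rewrite -[X in _ --> X]mulr1.
have inv0 : n%:R / N%:R @[N --> \oo] --> (0 : R).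
  apply/cvgrPdist_le => eps e0; near=> N.
  rewrite sub0r normrN ger0_norm ?divr_ge0 //.
  have N0 : (0 : R) < N%:R by rewrite ltr0n; near: N; exact: nbhs_infty_gt.
  rewrite ler_pdivrMr // -ler_pdivrMl // mulrC ltW //.
  by near: N; exact: nbhs_infty_gtr.
have step : 1 - n%:R / N%:R @[N --> \oo] --> (1 : R).
  by rewrite -[X in _ --> X]subr0; apply: cvgB => //; exact: cvg_cst.
apply: cvg_trans (cvgM IH step); apply: near_eq_cvg; near=> N.
have nN : (n <= N)%N by near: N; exact: nbhs_infty_ge.
have N0 : N%:R != 0 :> R by rewrite pnatr_eq0 -lt0n; near: N; exact: nbhs_infty_gt.
rewrite ffactnSr natrM natrB // exprSr invfM /=.
by rewrite mulrACA; congr (_ * _); rewrite mulrBl divff.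
Unshelve. all: by end_near. Qed.

Lemma card_injectiveb N : #|[pred phi : {ffun W -> 'I_N} | injectiveb phi]| = (N ^_ #|W|)%N.
Proof.
rewrite -[in RHS](card_ord N) -card_inj_ffuns; apply: eq_card => phi.
by rewrite !inE.
Qed.

(** The bound uses [|C|] because the hypothesis is void when [N < #|W|], and [C] may then be
    negative. *)
Lemma norm_injective_sum_le N (F : {ffun W -> 'I_N} -> R) C :
  (forall phi : {ffun W -> 'I_N}, injective phi -> `|F phi| <= C) ->
  `|\sum_(phi : {ffun W -> 'I_N} | injectiveb phi) F phi| <= N%:R ^+ #|W| * `|C|.
Proof.
move=> hC; apply: le_trans (ler_norm_sum _ _ _) _.
apply: (@le_trans _ _ (\sum_(phi : {ffun W -> 'I_N} | injectiveb phi) `|C|)).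
  by apply: ler_sum => phi /injectiveP /hC /le_trans; apply; exact: ler_norm.
rewrite sumr_const card_injectiveb -[leLHS]mulr_natl ler_wpM2r // -natrX ler_nat.
elim: #|W| => [|n IH]; first by rewrite ffactn0 expn0.
by rewrite ffactnSr expnSr leq_mul // leq_subr.
Qed.

Lemma cvg_injective_sum0 c C : (#|W| < c)%N ->
  (\forall N \near \oo, forall phi : {ffun W -> 'I_N}, injective phi -> `|B phi| <= C) ->
  (N%:R ^+ c)^-1 * \sum_(phi : {ffun W -> 'I_N} | injectiveb phi) B phi
    @[N --> \oo] --> 0.
Proof.
move=> Wc hC; apply/cvgrPdist_le => eps e0; near=> N.
have N1 : (0 < N)%N by near: N; exact: nbhs_infty_gt.
have N0 : (0 : R) < N%:R by rewrite ltr0n.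
have le : `|\sum_(phi : {ffun W -> 'I_N} | injectiveb phi) B phi| <= N%:R ^+ #|W| * `|C|.
  by apply: norm_injective_sum_le; near: N.
rewrite sub0r normrN normrM gtr0_norm ?invr_gt0 ?exprn_gt0 //.
rewrite ler_pdivrMl ?exprn_gt0 //; apply: le_trans le _.
(* Of the powers of [N] beyond [#|W|], one absorbs [|C| / eps] and the others are at least 1. *)
rewrite -(subnKC Wc) exprD exprSr -!mulrA ler_pM2l ?exprn_gt0 //.
apply: (@le_trans _ _ (N%:R * eps)).
  rewrite -ler_pdivrMr // ltW //; near: N; exact: nbhs_infty_gtr.
rewrite ler_pM2l // ler_peMl ?(ltW e0) // exprn_ege1 // ler1n.
by [].
Unshelve. all: by end_near. Qed.

Lemma cvg_injective_sum (L : R) :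
  (forall eps, 0 < eps -> \forall N \near \oo,
    forall phi : {ffun W -> 'I_N}, injective phi -> `|B phi - L| <= eps) ->
  (N%:R ^+ #|W|)^-1 * \sum_(phi : {ffun W -> 'I_N} | injectiveb phi) B phi
    @[N --> \oo] --> L.
Proof.
(* Split [B] as [(B - L) + L]: the first sum is uniformly small, and the second is [L] times the
   proportion of injective labellings. *)
move=> hL; rewrite (_ : (fun N => _) = (fun N => (N%:R ^+ #|W|)^-1 *
    (\sum_(phi : {ffun W -> 'I_N} | injectiveb phi) (B phi - L)) +
    (N ^_ #|W|)%:R / N%:R ^+ #|W| * L)); last first.
  apply/funext => N; rewrite sumrB sumr_const card_injectiveb mulrBr -[L *+ _]mulr_natl.
  by rewrite mulrA [_ * _%:R]mulrC subrK.
rewrite -[X in _ --> X]add0r -[X in _ --> _ + X]mul1r.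
apply: cvgD; last by apply: cvgM; [exact: cvg_ffact|exact: cvg_cst].
apply/cvgrPdist_le => eps e0; near=> N.
have N0 : (0 : R) < N%:R by rewrite ltr0n; near: N; exact: nbhs_infty_gt.
rewrite sub0r normrN normrM gtr0_norm ?invr_gt0 ?exprn_gt0 //.
rewrite ler_pdivrMl ?exprn_gt0 // -[X in _ * X](gtr0_norm e0).
by apply: norm_injective_sum_le; near: N; exact: hL.
Unshelve. all: by end_near. Qed.

End InjectiveSums.

(** * Limit of the expected trace *)

(** Supplies the default vertex of [edge_tuple]. A node of the nonempty incidence graph is a vertex,
    or a hyperedge containing one because [p > 0]. *)
Lemma hquotient_vertex (V : finType) (pi : {set {set V}})
    (pi_part : finset.partition pi [set: V]%SET) (p : nat) (h : hypergraph V) :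
  (0 < p)%N -> uniform p h -> hconnected h -> {B : {set V} | B \in pi}.
Proof.
move=> p0 uh [h0 _].
suff [v _] : {v : V | true} by exact: (block pi_part v).
apply: sigW; have /card_gt0P[[v|j] _] := h0; first by exists v.
have : (0 < size (nth mset0 h j : {mset V}%mset))%N.
  by rewrite (uh (nth mset0 h j)) // mem_nth.
by case: (nth mset0 h j : seq V) => [|v l] // _; exists v.
Qed.

Theorem corollary1p4 (R : realType) (p : nat) (hp : (2 <= p)%N)
  (V : finType) (h : hypergraph V)
  (h_connected : hconnected h) (h_uniform : uniform p h) (h_regular : regular 2 h)
  (pi : {set {set V}}) (pi_part : finset.partition pi [set: V]%SET)
  (d : nat -> measure_display) (Omega : forall N, measurableType (d N))
  (P : forall N, probability (Omega N) R)
  (T : forall N, p.-tuple 'I_N -> {RV (P N) >-> R})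
  (M : nat -> R) (M1 : M 1%N = 0)
  (T_heavy_wigner : heavy_wigner T M) :
  let g := hquotient pi_part h in
  ('E_(P N)[fun w => tr0 g (fun i => T N i w)])%E @[N --> \oo] -->
  (* all multiplicities are at most [size g], so [htype g r = 0] beyond it *)
  ((`[< two_divisible_hypertree g >]%:R)
     * \prod_(1 <= r < (size g).+1) M r ^+ htype g r)%:E.
Proof.
move=> g; have p0 : (0 < p)%N := ltnW hp.
have v0 := hquotient_vertex pi_part p0 h_uniform h_connected.
have g_uniform : uniform p g := hquotient_uniform h_uniform.
have g_connected : hconnected (forget_mult g) := hquotient_connected pi_part h_connected.
have g_even v : ~~ odd (degree g v).
  rewrite degree_hquotient (big_ind (fun n => ~~ odd n)) //.
    by move=> a b; rewrite oddD => /negbTE-> /negbTE->.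
  by move=> w _; rewrite h_regular.
pose W : finType := {B : {set V} | B \in pi}.
pose q := size (undup g).
(* Each moment is rescaled by [N^(p-1)], which makes it bounded uniformly in the labelling. *)
pose b (e : {mset W}%mset) N (phi : {ffun W -> 'I_N}) : R :=
  N%:R ^+ p.-1 * moment T (g e) (edge_tuple p v0 phi e).
pose B N (phi : {ffun W -> 'I_N}) : R := \prod_(e <- undup g) b e N phi.
have g_pos e : e \in g -> (1 <= g e)%N by rewrite in_mset.
have [C hC] : exists C, \forall N \near \oo, forall phi : {ffun W -> 'I_N},
    injective phi -> `|B N phi| <= C.
  apply: prod_uniform_bounded => e; rewrite mem_undup => eg.
  have [C hC] := moment_bounded T_heavy_wigner (g_pos e eg).
  exists C; apply: filterS hC => N hN phi _.
  by have [_] := hN (edge_tuple p v0 phi e).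
(* Induction on the list of hyperedges intersects finitely many conditions that hold for large
   [N]. *)
have hint : \forall N \near \oo, forall e, e \in g -> forall i,
    (P N).-integrable setT (fun w => (T N i w ^+ g e)%:E).
  suff H (s : seq {mset W}%mset) : {subset s <= g} -> \forall N \near \oo,
      forall e, e \in s -> forall i, (P N).-integrable setT (fun w => (T N i w ^+ g e)%:E).
    exact: (H g).
  elim: s => [_|e s IH sg]; first by near=> N.
  have [C' hC'] := moment_bounded T_heavy_wigner (g_pos e (sg e (mem_head _ _))).
  have /IH hs : {subset s <= g} by move=> f fs; apply: sg; rewrite inE fs orbT.
  near=> N => f; rewrite inE => /orP[/eqP -> i|fs]; last first.
    by move: f fs; near: N.
  suff [] : (P N).-integrable setT (fun w => (T N i w ^+ g e)%:E) /\
    `|N%:R ^+ p.-1 * moment T (g e) i| <= C' by [].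
  by move: i; near: N.
(* In the exponent, [q * p.-1] compensates the rescalings of the [q] moments, and the extra 1 is the
   factor [1/N] of [tr0]. *)
have hE : \forall N \near \oo,
    ((N%:R ^+ (q * p.-1).+1)^-1 * \sum_(phi : {ffun W -> 'I_N} | injectiveb phi) B N phi)%:E
    = ('E_(P N)[fun w => tr0 g (fun i => T N i w)])%E.
  near=> N; have N0 : N%:R != 0 :> R.
    by rewrite pnatr_eq0 -lt0n; near: N; exact: nbhs_infty_gt.
  rewrite (expectation_tr0 T_heavy_wigner v0 g_uniform); last by near: N.
  congr EFin; rewrite exprS invfM -mulrA; congr (_ * _); rewrite mulr_sumr.
  apply: eq_bigr => phi _; rewrite /B /b big_split /= big_const_seq count_predT.
  by rewrite iter_mulr_1 -exprM mulnC mulKf // expf_neq0.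
apply: cvg_trans (near_eq_cvg hE) _.
apply: cvg_EFin; first exact: nearW.
(* The exponent [(q * p.-1).+1] exceeds the number of vertices when [g] is not a fat hypertree, so
   the limit is 0; it equals that number when [g] is one. *)
have [fat|nfat] := pselect (fat_hypertree g); last first.
  rewrite asboolF ?mul0r; last by case.
  apply: cvg_injective_sum0 hC; rewrite ltnS.
  exact: card_not_fat_hypertree.
have two_div := even_degree_two_divisible g_uniform hp fat g_even.
rewrite asboolT // mul1r prod_htype -(card_fat_hypertree g_uniform p0 fat).
apply: cvg_injective_sum; apply: prod_uniform_cvg => e; rewrite mem_undup => eg eps e0.
(* A positive even multiplicity is at least 2, the range in which the scaled moments converge. *)
have ge2 : (2 <= g e)%N.
  by have := g_pos e eg; have := two_div.2 e eg; case: (g e) => [|[]].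
have cvgM := moment_cvg T_heavy_wigner ge2 e0.
apply: filterS cvgM => N hN phi phi_inj; apply: hN.
apply: edge_tuple_ltn_sorted => //; first exact: g_uniform.
by case: fat => /hsimple_forget_mult/(_ e eg).
Unshelve. all: by end_near. Qed.
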